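(* For any Minsky machine program $P$ with $n$ registers, one can compute a regular FRACTRAN program $Q$ such that for all $x_1,\dots,x_n\in\mathbb N$, $$(1,P)\text{ terminates from }(1,[x_1;\dots;x_n])\iff Q\text{ terminates from }\mathfrak p_1\,\mathfrak q_1^{x_1}\cdots\mathfrak q_n^{x_n}.$$
   Context: Minsky machines. An instruction over $n$ registers is $\mathrm{INC}\,\alpha$ or $\mathrm{DEC}\,\alpha\,p$ with $\alpha<n$ and $p\in\mathbb N$. A machine $(s,[\iota_0;\dots;\iota_k])$ has $\iota_j$ at label $s+j$. A state is $(i,\vec v)$. If $i$ labels an instruction, one step is as follows. - $\mathrm{INC}\,\alpha$ goes to $(i+1,\vec v[\alpha\mapsto v_\alpha+1])$. - $\mathrm{DEC}\,\alpha\,p$ goes to $(i+1,\vec v[\alpha\mapsto v_\alpha-1])$ if $v_\alpha>0$, and to $(p,\vec v)$ if $v_\alpha=0$. A machine terminates from a state if, after finitely many steps, it reaches a state with program counter outside the code. FRACTRAN. A program is a list of pairs $(p,q)\in\mathbb N^2$, written $p/q$. The step relation $Q:x\succ y$ is defined inductively. - $(p/q::Q'):x\succ y$ if $qy=px$. - $(p/q::Q'):x\succ y$ if $q\nmid px$ and $Q':x\succ y$. $Q$ terminates from $s$ if some $x$ reachable from $s$ in finitely many steps admits no $y$ with $Q:x\succ y$. A program is regular if all its denominators $q$ are nonzero. $\mathfrak p_0,\mathfrak p_1,\dots$ and $\mathfrak q_0,\mathfrak q_1,\dots$ are two fixed sequences of primes, all pairwise distinct. *)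

(* Defs.v *)
From mathcomp Require Import all_boot.
From Stdlib Require Import Relation_Operators.

Set Implicit Arguments.
Unset Strict Implicit.
Unset Printing Implicit Defensive.

(** ** Minsky machines *)

Inductive mm_instr (n : nat) : Type :=
  | INC of 'I_n
  | DEC of 'I_n & nat.

Arguments INC {n} _.
Arguments DEC {n} _ _.

Definition mm_program (n : nat) : Type := seq (mm_instr n).

Definition mm_machine (n : nat) : Type := (nat * mm_program n)%type.

Definition mm_state (n : nat) : Type := (nat * {ffun 'I_n -> nat})%type.

Definition mm_instr_at n (M : mm_machine n) (i : nat) : option (mm_instr n) :=
  if M.1 <= i then onth M.2 (i - M.1) else None.

Definition mm_update n (v : {ffun 'I_n -> nat}) (a : 'I_n) (c : nat) :
  {ffun 'I_n -> nat} := [ffun b => if b == a then c else v b].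

Inductive mm_step n (M : mm_machine n) : mm_state n -> mm_state n -> Prop :=
  | mm_step_inc i (v : {ffun 'I_n -> nat}) a :
      mm_instr_at M i = Some (INC a) ->
      mm_step M (i, v) (i.+1, mm_update v a (v a).+1)
  | mm_step_dec_pos i (v : {ffun 'I_n -> nat}) a p :
      mm_instr_at M i = Some (DEC a p) -> 0 < v a ->
      mm_step M (i, v) (i.+1, mm_update v a (v a).-1)
  | mm_step_dec_zero i (v : {ffun 'I_n -> nat}) a p :
      mm_instr_at M i = Some (DEC a p) -> v a = 0 ->
      mm_step M (i, v) (p, v).

Definition mm_outside n (M : mm_machine n) (i : nat) : Prop :=
  i < M.1 \/ M.1 + size M.2 <= i.

Definition mm_terminates n (M : mm_machine n) (st : mm_state n) : Prop :=
  exists2 st' : mm_state n,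
    clos_refl_trans _ (mm_step M) st st' & mm_outside M st'.1.

(** ** FRACTRAN *)

(* [(p, q)] stands for the fraction p/q, which need not be reduced. *)
Definition fractran : Type := seq (nat * nat).

Inductive fractran_step : fractran -> nat -> nat -> Prop :=
  | fractran_step_here p q Q x y :
      q * y = p * x -> fractran_step ((p, q) :: Q) x y
  | fractran_step_there p q Q x y :
      ~~ (q %| p * x) -> fractran_step Q x y ->
      fractran_step ((p, q) :: Q) x y.

Definition fractran_terminates (Q : fractran) (s : nat) : Prop :=
  exists2 x, clos_refl_trans _ (fractran_step Q) s x &
    forall y, ~ fractran_step Q x y.

Definition fractran_regular (Q : fractran) : Prop :=
  forall pq, pq \in Q -> pq.2 != 0.

(** ** Computability *)

(* Total functions that are recursive relative to the unary functions in [O]: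
   the least class containing the basic functions and [O] and closed under
   composition, primitive recursion ([iteri n g x] is
   [g n.-1 (... (g 0 x))]) and minimization of functions that have a zero
   for every value of the parameters. *)
Inductive recursive_in (O : (nat -> nat) -> Prop) :
    forall k : nat, (k.-tuple nat -> nat) -> Prop :=
  | rec_zero k : recursive_in O (fun _ : k.-tuple nat => 0)
  | rec_succ : recursive_in O (fun v : 1.-tuple nat => (thead v).+1)
  | rec_proj k (i : 'I_k) : recursive_in O (fun v : k.-tuple nat => tnth v i)
  | rec_oracle g : O g -> recursive_in O (fun v : 1.-tuple nat => g (thead v))
  | rec_comp m k (f : m.-tuple nat -> nat) (g : 'I_m -> k.-tuple nat -> nat) :
      recursive_in O f -> (forall i, recursive_in O (g i)) ->
      recursive_in O (fun v : k.-tuple nat => f [tuple g i v | i < m])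
  | rec_primrec k (f : k.-tuple nat -> nat) (g : k.+2.-tuple nat -> nat) :
      recursive_in O f -> recursive_in O g ->
      recursive_in O (fun v : k.+1.-tuple nat =>
        iteri (thead v)
          (fun i r => g (cons_tuple i (cons_tuple r (behead_tuple v))))
          (f (behead_tuple v)))
  | rec_min k (f : k.+1.-tuple nat -> nat) (h : k.-tuple nat -> nat) :
      recursive_in O f ->
      (forall v, f (cons_tuple (h v) v) = 0 /\
         forall m, m < h v -> f (cons_tuple m v) <> 0) ->
      recursive_in O h.

(* Goedel numberings; [CodeSeq.code : seq nat -> nat] is the bijection with
   [code [::] = 0] and [code (m :: s) = 2 ^ m * (2 * code s + 1)]. *)
Definition mm_instr_code n (iota : mm_instr n) : nat :=
  match iota with
  | INC a => CodeSeq.code [:: 0; val a]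
  | DEC a p => CodeSeq.code [:: 1; val a; p]
  end.

Definition mm_code n (P : mm_program n) : nat :=
  CodeSeq.code (map (@mm_instr_code n) P).

Definition fractran_code (Q : fractran) : nat :=
  CodeSeq.code [seq CodeSeq.code [:: pq.1; pq.2] | pq <- Q].

(* The input of a translation consists of the number of registers and the
   program. *)
Definition computable_translation (O : (nat -> nat) -> Prop)
    (f : forall n : nat, mm_program n -> fractran) : Prop :=
  exists2 F : 2.-tuple nat -> nat, recursive_in O F &
    forall (n : nat) (P : mm_program n),
      fractran_code (f n P) = F [tuple n; mm_code P].

(** ** Prime sequences *)

Definition distinct_primes (pp qq : nat -> nat) : Prop :=
  [/\ forall i, prime (pp i), forall i, prime (qq i),
      injective pp, injective qq & forall i j, pp i <> qq j].

(* Register [a : 'I_n], counted from 0, is stored at the prime [qq a.+1]. *)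
Definition mm_encode (pp qq : nat -> nat) n (x : {ffun 'I_n -> nat}) : nat :=
  pp 1 * \prod_(a < n) qq a.+1 ^ x a.

(* Main.v *)
Require Import Defs.
From mathcomp Require Import all_boot.
From Stdlib Require Import Relation_Operators Operators_Properties.
From Stdlib Require Import FunctionalExtensionality.

(* A machine state [(i, v)] is stored as the number
   [pp i * \prod_a qq a.+1 ^ v a], and the instruction at label [i] becomes a
   few fractions whose denominators contain [pp i] or a prime [qq (n + i)]
   private to that label.  Only the fractions of the current label can
   fire, so one machine step is one or two steps of the FRACTRAN program, and a
   state outside the code is stuck.  FRACTRAN being deterministic for nonzero
   denominators, termination transfers in both directions.  The translation is
   primitive recursive in the two prime sequences, apart from the 2-adic
   valuation, which is obtained by minimization and decodes a list. *)

Set Implicit Arguments.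
Unset Strict Implicit.
Unset Printing Implicit Defensive.

(** * Recursive functions *)

Section RecursiveFunctions.

Variable O : (nat -> nat) -> Prop.

(** The constructors of [recursive_in] fix a function up to conversion only, so functional
    extensionality is what transports the property to a pointwise equal function. *)
Lemma recursive_ext k (f g : k.-tuple nat -> nat) :
  f =1 g -> recursive_in O f -> recursive_in O g.
Proof. by move=> /functional_extensionality ->. Qed.

Lemma recursive_comp1 k (h : nat -> nat) (f : k.-tuple nat -> nat) :
  recursive_in O (fun v : 1.-tuple nat => h (thead v)) -> recursive_in O f ->
  recursive_in O (fun v => h (f v)).
Proof.
move=> Rh Rf.
have := @rec_comp O 1 k _ (fun _ => f) Rh (fun _ => Rf).
by apply: recursive_ext => v; rewrite /thead tnth_mktuple.
Qed.

Lemma recursive_succ k (f : k.-tuple nat -> nat) :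
  recursive_in O f -> recursive_in O (fun v => (f v).+1).
Proof. exact: recursive_comp1 (rec_succ O). Qed.

Lemma recursive_const k c : recursive_in O (fun _ : k.-tuple nat => c).
Proof. by elim: c => [|c IH]; [exact: rec_zero | exact: recursive_succ IH]. Qed.

Lemma recursive_thead k : recursive_in O (fun w : k.+1.-tuple nat => thead w).
Proof. exact: rec_proj. Qed.

Lemma recursive_behead k (f : k.-tuple nat -> nat) :
  recursive_in O f ->
  recursive_in O (fun w : k.+1.-tuple nat => f (behead_tuple w)).
Proof.
move=> Rf.
have := @rec_comp O k k.+1 f (fun i w => tnth w (lift ord0 i)) Rf
  (fun i => rec_proj _ _).
apply: recursive_ext => w; congr f.
by apply: eq_from_tnth => i; rewrite tnth_mktuple tnth_behead; congr tnth;
  apply: val_inj; rewrite /= inordK // ltnS ltn_ord.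
Qed.

Lemma recursive_cons k (f : k.+1.-tuple nat -> nat) (h : k.-tuple nat -> nat) :
  recursive_in O f -> recursive_in O h ->
  recursive_in O (fun v => f (cons_tuple (h v) v)).
Proof.
move=> Rf Rh.
have Rg i : recursive_in O (fun v => tnth (cons_tuple (h v) v) i).
  case: (unliftP ord0 i) => [j|] ->; last by apply: recursive_ext Rh => v; rewrite tnth0.
  by apply: recursive_ext (rec_proj O j) => v; rewrite tnthS.
have := rec_comp Rf Rg.
by apply: recursive_ext => v; congr f; apply: eq_from_tnth => i; rewrite tnth_mktuple.
Qed.

(** [rec_primrec] takes the number of rounds from its first argument; substituting [h v] there with
    [recursive_cons] allows any recursive bound. *)
Lemma recursive_iteri k (h b : k.-tuple nat -> nat)
    (g : nat -> nat -> k.-tuple nat -> nat) :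
  recursive_in O h -> recursive_in O b ->
  recursive_in O (fun w : k.+2.-tuple nat =>
    g (thead w) (thead (behead_tuple w)) (behead_tuple (behead_tuple w))) ->
  recursive_in O (fun v => iteri (h v) (fun i r => g i r v) (b v)).
Proof.
move=> Rh Rb Rg.
have := recursive_cons (rec_primrec Rb Rg) Rh.
apply: recursive_ext => v.
have -> : behead_tuple (cons_tuple (h v) v) = v by apply: val_inj.
rewrite theadE; elim: (h v) => //= m ->; congr g; rewrite /thead.
by apply: val_inj.
Qed.

Lemma recursive_iter k (h b : k.-tuple nat -> nat) (g : nat -> nat) :
  recursive_in O h -> recursive_in O b ->
  recursive_in O (fun v : 1.-tuple nat => g (thead v)) ->
  recursive_in O (fun v => iter (h v) g (b v)).
Proof.
move=> Rh Rb Rg.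
have := @recursive_iteri k h b (fun _ r _ => g r) Rh Rb
  (recursive_comp1 Rg (recursive_behead (recursive_thead _))).
by apply: recursive_ext => v; elim: (h v) => //= m ->.
Qed.

Lemma recursive_add k (f g : k.-tuple nat -> nat) :
  recursive_in O f -> recursive_in O g -> recursive_in O (fun v => f v + g v).
Proof.
move=> Rf Rg.
have := recursive_iter (g := succn) Rf Rg (recursive_succ (recursive_thead _)).
by apply: recursive_ext => v; rewrite iter_succn addnC.
Qed.

Lemma recursive_mul k (f g : k.-tuple nat -> nat) :
  recursive_in O f -> recursive_in O g -> recursive_in O (fun v => f v * g v).
Proof.
move=> Rf Rg.
have := @recursive_iteri k f _ (fun _ r v => g v + r) Rf (recursive_const _ 0)
  (recursive_add (recursive_behead (recursive_behead Rg))
     (recursive_behead (recursive_thead _))).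
by apply: recursive_ext => v; elim: (f v) => //= m ->; rewrite mulSn.
Qed.

Lemma recursive_pred k (f : k.-tuple nat -> nat) :
  recursive_in O f -> recursive_in O (fun v => (f v).-1).
Proof.
move=> Rf.
(* Each round returns its own index, so the last of [f v] rounds leaves the predecessor. *)
have := @recursive_iteri k f _ (fun i _ _ => i) Rf (recursive_const _ 0)
  (recursive_thead _).
by apply: recursive_ext => v; case: (f v).
Qed.

Lemma recursive_sub k (f g : k.-tuple nat -> nat) :
  recursive_in O f -> recursive_in O g -> recursive_in O (fun v => f v - g v).
Proof.
move=> Rf Rg.
have := recursive_iter (g := predn) Rg Rf (recursive_pred (recursive_thead _)).
by apply: recursive_ext => v; rewrite iter_predn.
Qed.

Lemma recursive_if0 k (t f g : k.-tuple nat -> nat) :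
  recursive_in O t -> recursive_in O f -> recursive_in O g ->
  recursive_in O (fun v => if t v == 0 then f v else g v).
Proof.
move=> Rt Rf Rg.
(* A round discards the accumulator: no round leaves [f v], any positive number of rounds leaves
   [g v]. *)
have := @recursive_iteri k t f (fun _ _ v => g v) Rt Rf
  (recursive_behead (recursive_behead Rg)).
by apply: recursive_ext => v; case: (t v).
Qed.

Lemma recursive_odd k (f : k.-tuple nat -> nat) :
  recursive_in O f -> recursive_in O (fun v => nat_of_bool (odd (f v))).
Proof.
move=> Rf.
have := recursive_iter (g := subn 1) Rf (recursive_const _ 0)
  (recursive_sub (recursive_const _ 1) (recursive_thead _)).
by apply: recursive_ext => v; elim: (f v) => //= m ->; case: odd.
Qed.

Lemma recursive_half k (f : k.-tuple nat -> nat) :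
  recursive_in O f -> recursive_in O (fun v => (f v)./2).
Proof.
move=> Rf.
(* The half of [m] is the number of odd integers below [m]. *)
have := @recursive_iteri k f _ (fun i r _ => odd i + r) Rf (recursive_const _ 0)
  (recursive_add (recursive_odd (recursive_thead _))
     (recursive_behead (recursive_thead _))).
by apply: recursive_ext => v; elim: (f v) => //= m ->; rewrite uphalf_half.
Qed.

Lemma recursive_exp2 k (f : k.-tuple nat -> nat) :
  recursive_in O f -> recursive_in O (fun v => 2 ^ f v).
Proof.
move=> Rf.
have := recursive_iter (g := fun r => r + r) Rf (recursive_const _ 1)
  (recursive_add (recursive_thead _) (recursive_thead _)).
by apply: recursive_ext => v; elim: (f v) => //= m ->; rewrite expnS mul2n addnn.
Qed.

(** * The 2-adic valuation and coded lists *)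

Lemma iter_half_exp2 m a b : iter m half (2 ^ (m + a) * b) = 2 ^ a * b.
Proof.
elim: m => //= m <-; rewrite -iterS iterSr addSn expnS -mulnA mul2n.
by rewrite doubleK.
Qed.

(** The valuation is the least [m] such that [m] halvings give an odd number. The factor [f v] in
    the test makes it vanish at [m = 0] when [f v = 0], in agreement with [logn 2 0 = 0]. *)
Lemma recursive_logn2 k (f : k.-tuple nat -> nat) :
  recursive_in O f -> recursive_in O (fun v => logn 2 (f v)).
Proof.
move=> Rf.
have Rhalf := recursive_half (recursive_thead 0).
have Rit : recursive_in O (fun w : k.+1.-tuple nat =>
    f (behead_tuple w) *
      (1 - odd (iter (thead w) half (f (behead_tuple w))))).
  apply: recursive_mul (recursive_behead Rf) _.
  apply: recursive_sub (recursive_const _ 1) (recursive_odd _).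
  exact: recursive_iter (recursive_thead _) (recursive_behead Rf) Rhalf.
apply: rec_min Rit _ => v /=.
set h := logn 2 (f v).
have beheadE m : behead_tuple (cons_tuple m v) = v by apply: val_inj.
rewrite theadE beheadE; case: (posnP (f v)) => [fv0|fv_gt0].
  by rewrite /h fv0.
have [d] := pfactor_coprime (isT : prime 2) fv_gt0.
rewrite coprime2n -/h mulnC => d_odd def_f; split=> [|m lt_mh].
  by rewrite def_f -[h in 2 ^ h]addn0 iter_half_exp2 mul1n d_odd subnn muln0.
rewrite theadE beheadE [in iter _ _ _]def_f -(subnKC (ltnW lt_mh)) iter_half_exp2 oddM.
rewrite oddX orbF subn_eq0 leqNgt lt_mh /= subn0 muln1 => fv0.
by rewrite fv0 in fv_gt0.
Qed.

Lemma recursive_code_cons k (f g : k.-tuple nat -> nat) :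
  recursive_in O f -> recursive_in O g ->
  recursive_in O (fun v => 2 ^ f v * (g v).*2.+1).
Proof.
move=> Rf Rg; apply: recursive_mul (recursive_exp2 Rf) (recursive_succ _).
by apply: recursive_ext (recursive_add Rg Rg) => v; rewrite addnn.
Qed.

(** On [2 ^ m * (2 * c' + 1)], the first [m] halvings remove the power of two and one more yields
    [c']; the code 0 of the empty list is fixed. *)
Definition code_behead c := iter (logn 2 c).+1 half c.

Lemma recursive_code_behead k (f : k.-tuple nat -> nat) :
  recursive_in O f -> recursive_in O (fun v => code_behead (f v)).
Proof.
move=> Rf; apply: recursive_iter (recursive_succ (recursive_logn2 Rf)) Rf _.
exact: recursive_half (recursive_thead _).
Qed.

End RecursiveFunctions.

Lemma logn2_code m s : logn 2 (CodeSeq.code (m :: s)) = m.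
Proof.
rewrite /= lognM ?expn_gt0 // pfactorK // logn_coprime ?addn0 //.
by rewrite coprime2n /= odd_double.
Qed.

Lemma code_behead_code s : code_behead (CodeSeq.code s) = CodeSeq.code (behead s).
Proof.
case: s => [|m s]; first by rewrite /code_behead logn0.
rewrite /code_behead logn2_code iterS /= -[m in 2 ^ m]addn0 iter_half_exp2.
by rewrite mul1n /= uphalf_double.
Qed.

Lemma iter_code_behead m s :
  iter m code_behead (CodeSeq.code s) = CodeSeq.code (drop m s).
Proof.
by elim: m s => [|m IH] s; rewrite ?drop0 // iterSr code_behead_code IH; case: s.
Qed.

Lemma size_le_code s : size s <= CodeSeq.code s.
Proof.
elim: s => //= m s IH; apply: leq_trans (leq_pmull _ _); last by rewrite expn_gt0.
by rewrite ltnS (leq_trans IH) // -addnn leq_addr.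
Qed.

(** * The translation *)

Section Translation.

Variables pp qq : nat -> nat.

(* A conditional jump passes through the prime [qq (n + i)], which serves no
   register: the fraction [pp p / pp i] would fire on every number when
   [p = i]. *)
Definition instr_fractions n i (iota : mm_instr n) : fractran :=
  match iota with
  | INC a => [:: (pp i.+1 * qq a.+1, pp i)]
  | DEC a p =>
      [:: (pp i.+1, pp i * qq a.+1); (qq (n + i), pp i); (pp p, qq (n + i))]
  end.

Fixpoint program_fractions n i (P : mm_program n) : fractran :=
  if P is iota :: P' then
    instr_fractions i iota ++ program_fractions i.+1 P'
  else [::].

(** [CodeSeq.code] unfolded on a list of fractions with head [(p, q)] and a tail of code [r]. *)
Definition code_fraction p q r :=
  2 ^ (2 ^ p * (2 ^ q * 0.*2.+1).*2.+1) * r.*2.+1.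

(** Here [h] codes an instruction as the list of its tag, its register and, for [DEC], its target;
    [r] codes the fractions that follow. *)
Definition code_instr_fractions n i h r :=
  let a := logn 2 (code_behead h) in
  let p := logn 2 (code_behead (code_behead h)) in
  if logn 2 h == 0 then code_fraction (pp i.+1 * qq a.+1) (pp i) r
  else code_fraction (pp i.+1) (pp i * qq a.+1)
        (code_fraction (qq (n + i)) (pp i)
          (code_fraction (pp p) (qq (n + i)) r)).

(* The instructions are processed from the last one to the first.  The code [c]
   bounds the length of the program; beyond it, [d] is [0]. *)
Definition code_step n c t r :=
  let k := c - t.+1 in
  let d := iter k code_behead c in
  if d == 0 then r else code_instr_fractions n k.+1 (logn 2 d) r.

Definition code_translation n c := iteri c (code_step n c) 0.

Lemma code_instr_fractionsE n i (iota : mm_instr n) Q :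
  fractran_code (instr_fractions i iota ++ Q) =
  code_instr_fractions n i (mm_instr_code iota) (fractran_code Q).
Proof.
case: iota => [a|a p]; rewrite /code_instr_fractions /mm_instr_code;
  by rewrite !code_behead_code /behead !logn2_code.
Qed.

Lemma code_translationE n (P : mm_program n) :
  fractran_code (program_fractions 1 P) = code_translation n (mm_code P).
Proof.
set c := mm_code P.
have sizeP : size P <= c by rewrite -(size_map (@mm_instr_code n)) size_le_code.
(* After [t] rounds the accumulator codes the translation of the instructions from position [c - t]
   on; labels exceed positions by one. *)
suff inv t : t <= c -> iteri t (code_step n c) 0 =
    fractran_code (program_fractions (c - t).+1 (drop (c - t) P)).
  by rewrite /code_translation inv // subnn drop0.
elim: t => [_|t IH lt_tc]; first by rewrite subn0 drop_oversize.
rewrite /= IH ?(ltnW lt_tc) // /code_step iter_code_behead.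
rewrite -map_drop -(subnSK lt_tc); set k := c - t.+1.
rewrite -[in drop k.+1 P]addn1 addnC -drop_drop.
(* While [k] is past the end of [P], [d] is 0 and the accumulator stays; the code of a nonempty list
   is positive. *)
case: (drop k P) => [|iota P'] //.
rewrite drop1 code_instr_fractionsE map_cons logn2_code.
by rewrite ifN // -lt0n muln_gt0 expn_gt0.
Qed.

Lemma computable_program_fractions :
  computable_translation (fun g => g = pp \/ g = qq)
    (fun n P => program_fractions 1 P).
Proof.
set O := fun _ => _.
exists (fun v => code_translation (tnth v ord0) (tnth v ord_max)); last first.
  by move=> n P; rewrite code_translationE.
have Rpp k f : recursive_in (k := k) O f -> recursive_in O (fun v => pp (f v)).
  by apply: recursive_comp1; apply: rec_oracle; left.
have Rqq k f : recursive_in (k := k) O f -> recursive_in O (fun v => qq (f v)).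
  by apply: recursive_comp1; apply: rec_oracle; right.
have Rfraction k p q r : recursive_in (k := k) O p -> recursive_in O q ->
    recursive_in O r -> recursive_in O (fun v => code_fraction (p v) (q v) (r v)).
  move=> Rp Rq Rr; do !apply: recursive_code_cons => //.
  exact: recursive_const.
have Rn : recursive_in O (fun v : 2.-tuple nat => tnth v ord0) by exact: rec_proj.
have Rc : recursive_in O (fun v : 2.-tuple nat => tnth v ord_max) by exact: rec_proj.
apply: (recursive_iteri (g := fun t r v =>
  code_step (tnth v ord0) (tnth v ord_max) t r)) => //; first exact: rec_zero.
(* The step function has the round and the accumulator as extra leading arguments, so the parameters
   move two places. *)
move/recursive_behead/recursive_behead in Rn.
move/recursive_behead/recursive_behead in Rc.
have Rt := recursive_thead O 3.
have Rr := recursive_behead (recursive_thead O 2).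
have Rk := recursive_sub Rc (recursive_succ Rt).
have Rd := recursive_iter Rk Rc (recursive_code_behead (recursive_thead O 0)).
have Rh := recursive_logn2 Rd.
have Ri := recursive_succ Rk.
have RSi := recursive_succ Ri.
have Ra := recursive_logn2 (recursive_code_behead Rh).
have Rp := recursive_logn2 (recursive_code_behead (recursive_code_behead Rh)).
have Rni := Rqq _ _ (recursive_add Rn Ri).
have Rqa := Rqq _ _ (recursive_succ Ra).
apply: recursive_if0 => //; apply: (recursive_if0 (recursive_logn2 Rh)).
  by apply: (Rfraction) => //; [apply: recursive_mul => //|]; exact: (Rpp).
apply: (Rfraction); [exact: (Rpp) | by apply: recursive_mul => //; exact: (Rpp) |].
apply: (Rfraction) => //; first exact: Rpp.
by apply: (Rfraction) => //; exact: Rpp.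
Qed.

(** * Simulation *)

Hypothesis hpq : distinct_primes pp qq.

Let pp_prime i : prime (pp i). Proof. by case: hpq. Qed.
Let qq_prime i : prime (qq i). Proof. by case: hpq. Qed.

Lemma dvdn_pp_pp i j : (pp i %| pp j) = (i == j).
Proof. by case: hpq => _ _ pp_inj _ _; rewrite dvdn_prime2 // inj_eq. Qed.

Lemma dvdn_qq_qq i j : (qq i %| qq j) = (i == j).
Proof. by case: hpq => _ _ _ qq_inj _; rewrite dvdn_prime2 // inj_eq. Qed.

Lemma dvdn_pp_qq i j : (pp i %| qq j) = false.
Proof. by case: hpq => _ _ _ _ neq; rewrite dvdn_prime2 //; apply/eqP. Qed.

Lemma dvdn_qq_pp i j : (qq i %| pp j) = false.
Proof. by case: hpq => _ _ _ _ neq; rewrite dvdn_prime2 // eq_sym; apply/eqP. Qed.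

Definition dvdn_ppqq := (dvdn_pp_pp, dvdn_qq_qq, dvdn_pp_qq, dvdn_qq_pp).

(** * Prime factors of the register product *)

Section Registers.

Variable n : nat.
Implicit Types (v : {ffun 'I_n -> nat}) (P : mm_program n).

Definition encode_registers v := \prod_(a < n) qq a.+1 ^ v a.

Lemma pp_dvd_registers i v : (pp i %| encode_registers v) = false.
Proof.
rewrite /encode_registers Euclid_dvd_prod // big1 // => a _.
by rewrite Euclid_dvdX // dvdn_ppqq.
Qed.

(** Registers occupy the indices 1 to [n], and labels start at 1, so the private prime of a label
    has a larger index. *)
Lemma qq_dvd_registers i v : (qq (n + i.+1) %| encode_registers v) = false.
Proof.
rewrite /encode_registers Euclid_dvd_prod // big1 // => a _.
rewrite Euclid_dvdX // dvdn_ppqq addnS eqSS gtn_eqF //.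
exact: leq_trans (ltn_ord a) (leq_addr _ _).
Qed.

Lemma register_dvd_registers (a : 'I_n) v :
  (qq a.+1 %| encode_registers v) = (0 < v a).
Proof.
rewrite /encode_registers Euclid_dvd_prod // (bigD1 a) //= big1 => [|b /negPf ne_ba].
  by rewrite orbF Euclid_dvdX // dvdnn.
by rewrite Euclid_dvdX // dvdn_ppqq eqSS eq_sym (inj_eq val_inj) ne_ba.
Qed.

Lemma encode_registers_incr v (a : 'I_n) :
  encode_registers (mm_update v a (v a).+1) = qq a.+1 * encode_registers v.
Proof.
rewrite /encode_registers (bigD1 a) //= [in RHS](bigD1 a) //= ffunE eqxx expnS.
rewrite -mulnA; congr (_ * (_ * _)).
by apply: eq_bigr => b /negPf ne_ba; rewrite ffunE ne_ba.
Qed.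

Lemma encode_registers_decr v (a : 'I_n) : 0 < v a ->
  encode_registers v = qq a.+1 * encode_registers (mm_update v a (v a).-1).
Proof.
move=> va_gt0; rewrite -encode_registers_incr; congr encode_registers.
by apply/ffunP => b; rewrite !ffunE eqxx prednK //; case: eqP => // ->.
Qed.

(** * Stuck numbers and determinism *)

Definition inapplicable (Q : fractran) x :=
  all (fun pq => ~~ (pq.2 %| pq.1 * x)) Q.

Lemma fractran_step_skip Q1 Q2 x y :
  inapplicable Q1 x -> fractran_step Q2 x y -> fractran_step (Q1 ++ Q2) x y.
Proof.
by elim: Q1 => //= -[p q] Q1 IH /andP[nq /IH{}IH] /IH; apply: fractran_step_there.
Qed.

Lemma inapplicable_stuck Q x y : inapplicable Q x -> ~ fractran_step Q x y.
Proof.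
move=> + step_xy; elim: step_xy => {Q x y} [p q Q x y /= <-|p q Q x y _ _ IH].
  by rewrite dvdn_mulr.
by case/andP.
Qed.

(** The divisibility test decides which fraction fires, and its nonzero denominator cancels. *)
Lemma fractran_step_det Q x y z : fractran_regular Q ->
  fractran_step Q x y -> fractran_step Q x z -> y = z.
Proof.
move=> + step_xy; elim: step_xy z => {Q x y}
    [p q Q x y xy z regQ|p q Q x y nq _ IH z regQ] step_xz.
  inversion step_xz as [? ? ? ? ? xz|? ? ? ? ? nq]; subst.
    have /= := regQ _ (mem_head _ _).
    by rewrite -lt0n => q_gt0; apply/eqP; rewrite -(eqn_pmul2l q_gt0) xy xz.
  by rewrite -xy dvdn_mulr in nq.
inversion step_xz as [? ? ? ? ? xz|]; subst; first by rewrite -xz dvdn_mulr in nq.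
by apply: IH => // pq Qpq; apply: regQ; rewrite inE Qpq orbT.
Qed.

Lemma program_fractions_regular i P : fractran_regular (program_fractions i P).
Proof.
elim: P i => [|iota P IH] i pq //=; rewrite mem_cat => /orP[|/IH//].
by case: iota => [a|a p]; rewrite !inE; [|case/or3P]; move=> /eqP-> /=;
  rewrite -?lt0n ?muln_gt0 !prime_gt0.
Qed.

(** Each denominator has a factor [pp i] or [qq (n + i)] that divides neither the numerator, nor
    [s], nor the register product. The label part [s] stands for [pp j] as well as for the
    intermediate [qq (n + j)]. *)
Lemma instr_inapplicable i (iota : mm_instr n) s v : 0 < i ->
  ~~ (pp i %| s) -> ~~ (qq (n + i) %| s) ->
  inapplicable (instr_fractions i iota) (s * encode_registers v).
Proof.
move=> i_gt0 /negPf pp_s /negPf qq_s.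
have qq_v : (qq (n + i) %| encode_registers v) = false.
  by rewrite -(prednK i_gt0) qq_dvd_registers.
have neq_iS : (i == i.+1) = false by rewrite ltn_eqF.
case: iota => [a|a p] /=; rewrite ?andbT.
  by rewrite !Euclid_dvdM // !dvdn_ppqq neq_iS pp_s pp_dvd_registers.
apply/and3P; split.
(* The factor [pp i] of the denominator already fails to divide. *)
- apply: contraFN (erefl false) => /(dvdn_trans (dvdn_mulr _ (dvdnn _))).
  by rewrite !Euclid_dvdM // !dvdn_ppqq neq_iS pp_s pp_dvd_registers.
- by rewrite !Euclid_dvdM // !dvdn_ppqq pp_s pp_dvd_registers.
- by rewrite !Euclid_dvdM // !dvdn_ppqq qq_s qq_v.
Qed.

Lemma program_inapplicable i0 P i v : 0 < i0 -> i < i0 \/ i0 + size P <= i ->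
  inapplicable (program_fractions i0 P) (pp i * encode_registers v).
Proof.
elim: P i0 => //= iota P IH i0 i0_gt0 out; rewrite /inapplicable all_cat.
apply/andP; split.
  apply: instr_inapplicable => //; rewrite dvdn_ppqq //.
  case: out => [lt_i|le_i]; first by rewrite gtn_eqF.
  by rewrite ltn_eqF // (leq_trans _ le_i) // addnS ltnS leq_addr.
apply: IH => //; case: out => [/ltnW lt_i|]; [by left | by rewrite addnS -addSn; right].
Qed.

(** The fractions of earlier labels are skipped because [s] carries none of their primes; later ones
    are the arbitrary [Q], never reached. *)
Lemma program_step i0 P i iota s v y : 0 < i0 -> i0 <= i ->
  onth P (i - i0) = Some iota ->
  (forall j, j != i -> ~~ (pp j %| s) /\ ~~ (qq (n + j) %| s)) ->
  (forall Q, fractran_step (instr_fractions i iota ++ Q)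
    (s * encode_registers v) y) ->
  fractran_step (program_fractions i0 P) (s * encode_registers v) y.
Proof.
move=> + + + s_i step_i; elim: P i0 => [|iota' P IH] i0 i0_gt0 le_i0 /=.
  by rewrite onth0n.
case: (eqVneq i0 i) => [->|ne_i0]; first by rewrite subnn => -[->]; apply: step_i.
have lt_i0 : i0 < i by rewrite ltn_neqAle ne_i0.
rewrite -(subnSK lt_i0) => /(IH _ (ltn0Sn _) lt_i0); apply: fractran_step_skip.
by case: (s_i _ ne_i0) => pp_s qq_s; apply: instr_inapplicable.
Qed.

(** * Machine runs against FRACTRAN runs *)

Section Simulation.

Variable P : mm_program n.

Notation Q := (program_fractions 1 P).
Notation "x >--> y" := (fractran_step Q x y) (at level 70).
Notation encode st := (pp st.1 * encode_registers st.2).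

Lemma label_step i iota v y : mm_instr_at (1, P) i = Some iota ->
  (forall Q', fractran_step (instr_fractions i iota ++ Q')
    (pp i * encode_registers v) y) ->
  pp i * encode_registers v >--> y.
Proof.
rewrite /mm_instr_at /=; case: ltnP => // i_gt0 P_i; apply: (program_step _ _ P_i) => //.
by move=> j /negPf ne_ji; rewrite !dvdn_ppqq ne_ji.
Qed.

Lemma inc_step i a v : mm_instr_at (1, P) i = Some (INC a) ->
  pp i * encode_registers v >-->
    pp i.+1 * encode_registers (mm_update v a (v a).+1).
Proof.
move=> P_i; apply: label_step P_i _ => Q'; apply: fractran_step_here.
by rewrite encode_registers_incr mulnCA -mulnA [in RHS](mulnCA (qq _)).
Qed.

Lemma dec_pos_step i a p v : mm_instr_at (1, P) i = Some (DEC a p) -> 0 < v a ->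
  pp i * encode_registers v >-->
    pp i.+1 * encode_registers (mm_update v a (v a).-1).
Proof.
move=> P_i va_gt0; apply: label_step P_i _ => Q'; apply: fractran_step_here.
by rewrite (encode_registers_decr va_gt0) mulnCA -mulnA.
Qed.

Lemma dec_zero_step i a p v : mm_instr_at (1, P) i = Some (DEC a p) -> v a = 0 ->
  pp i * encode_registers v >--> qq (n + i) * encode_registers v.
Proof.
(* An empty register blocks the first fraction through its factor [qq a.+1]; the second one then
   fires. *)
move=> P_i va0; apply: label_step P_i _ => Q'; apply: fractran_step_there.
  apply: contraFN (erefl false) => /(dvdn_trans (dvdn_mull _ (dvdnn _))).
  by rewrite !Euclid_dvdM // !dvdn_ppqq register_dvd_registers va0.
by apply: fractran_step_here; rewrite mulnCA.
Qed.

Lemma jump_step i a p v : mm_instr_at (1, P) i = Some (DEC a p) ->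
  qq (n + i) * encode_registers v >--> pp p * encode_registers v.
Proof.
rewrite /mm_instr_at /=; case: ltnP => // i_gt0 P_i; apply: (program_step _ _ P_i) => //.
  by move=> j /negPf ne_ji; rewrite !dvdn_ppqq eqn_add2l ne_ji.
move=> Q'.
(* The first two denominators contain [pp i], absent from an intermediate number, so the third
   fraction fires, even when [p = i]. *)
have pp_qq : (pp i %| qq (n + i) * encode_registers v) = false.
  by rewrite Euclid_dvdM // dvdn_ppqq pp_dvd_registers.
apply: fractran_step_there.
  apply: contraFN (erefl false) => /(dvdn_trans (dvdn_mulr _ (dvdnn _))).
  by rewrite Euclid_dvdM // pp_qq dvdn_ppqq ltn_eqF.
apply: fractran_step_there; first by rewrite Euclid_dvdM // pp_qq dvdn_ppqq.
by apply: fractran_step_here; rewrite mulnCA.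
Qed.

Lemma outside_stuck st y : mm_outside (1, P) st.1 -> ~ (encode st >--> y).
Proof. by move=> out; apply/inapplicable_stuck/program_inapplicable. Qed.

Lemma mm_step_simulated st st' : mm_step (1, P) st st' ->
  clos_refl_trans _ (fractran_step Q) (encode st) (encode st').
Proof.
case=> {st st'} [i v a P_i|i v a p P_i va_gt0|i v a p P_i va0].
- by apply: rt_step; apply: inc_step.
- by apply: rt_step; apply: dec_pos_step P_i _.
- by apply: rt_trans (rt_step _ _ _ _ (dec_zero_step P_i va0)) (rt_step _ _ _ _ _);
    exact: jump_step P_i.
Qed.

(* The second case is the middle of a conditional jump: the machine has
   already jumped, the FRACTRAN program has not. *)
Definition represents x (st : mm_state n) :=
  x = encode st \/
  exists i a, mm_instr_at (1, P) i = Some (DEC a st.1) /\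
    x = qq (n + i) * encode_registers st.2.

(** Completing a jump costs the machine no step; every other FRACTRAN step matches exactly one
    machine step. *)
Lemma represents_progress x st : represents x st ->
  mm_outside (1, P) st.1 \/
  exists y st', [/\ x >--> y, represents y st' &
    clos_refl_trans _ (mm_step (1, P)) st st'].
Proof.
case=> [->|[i [a [P_i ->]]]]; last first.
  right; exists (encode st), st; split; [exact: jump_step P_i | by left | exact: rt_refl].
case: st => i v /=.
case P_i: (mm_instr_at (1, P) i) => [iota|]; last first.
  left; move: P_i; rewrite /mm_instr_at /mm_outside /=.
  case: ltnP => [i_gt0|]; last by left.
  move=> P_i; right; have := onthTE P (i - 1); rewrite P_i /= => /esym.
  by rewrite ltn_subLR // => /negbT; rewrite -leqNgt.
right; case: iota P_i => [a|a p] P_i.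
  exists (pp i.+1 * encode_registers (mm_update v a (v a).+1)).
  exists (i.+1, mm_update v a (v a).+1); split; [exact: inc_step | by left |].
  exact/rt_step/mm_step_inc.
case: (posnP (v a)) => [va0|va_gt0].
  exists (qq (n + i) * encode_registers v), (p, v); split.
  - exact: dec_zero_step P_i va0.
  - by right; exists i, a.
  - exact/rt_step/(mm_step_dec_zero P_i va0).
exists (pp i.+1 * encode_registers (mm_update v a (v a).-1)).
exists (i.+1, mm_update v a (v a).-1); split; [exact: dec_pos_step P_i va_gt0 | by left |].
exact/rt_step/(mm_step_dec_pos P_i va_gt0).
Qed.

Lemma terminates_iff st :
  mm_terminates (1, P) st <-> fractran_terminates Q (encode st).
Proof.
split=> [[st' steps out]|[z steps stuck]].
  exists (encode st') => [{out}|y]; last exact: outside_stuck.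
  elim: steps => [st1 st2|st1|st1 st2 st3 _ IH12 _ IH23].
  - exact: mm_step_simulated.
  - exact: rt_refl.
  - exact: rt_trans IH12 IH23.
have {steps} := clos_rt_rt1n _ _ _ _ steps.
have: represents (encode st) st by left.
(* The induction runs over all represented numbers, since a run also passes through intermediate
   ones. *)
move: (encode st) => x rep_x steps.
elim: steps stuck st rep_x => {x z} [z stuck|x y z step_xy _ IH stuck] st
    /represents_progress [out|[y' [st' [step_xy' rep_y' steps']]]].
- by exists st => //; exact: rt_refl.
- by case: (stuck _ step_xy').
- by exists st => //; exact: rt_refl.
(* By determinism the step given by [represents_progress] is the one that the run takes. *)
- rewrite -(fractran_step_det (@program_fractions_regular 1 P) step_xy step_xy') in rep_y'.
  case: (IH stuck _ rep_y') => st'' steps'' out.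
  by exists st'' => //; exact: rt_trans steps' steps''.
Qed.

End Simulation.

End Registers.

End Translation.

Theorem theorem6p3 (pp qq : nat -> nat) (hpq : distinct_primes pp qq) :
  exists f : forall n : nat, mm_program n -> fractran,
    computable_translation (fun g => g = pp \/ g = qq) f /\
    forall (n : nat) (P : mm_program n),
      fractran_regular (f n P) /\
      forall x : {ffun 'I_n -> nat},
        mm_terminates (1, P) (1, x) <->
        fractran_terminates (f n P) (mm_encode pp qq x).
Proof.
exists (fun n P => program_fractions pp qq 1 P); split.
  exact: computable_program_fractions.
move=> n P; split=> [|x]; first exact: program_fractions_regular.
(* [mm_encode pp qq x] is by conversion the encoding of the state [(1, x)]. *)
exact: terminates_iff.
Qed.
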